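(* Let $V$, ${\tt N}$, $\phi^j$, $\tilde{\cal F}^j$, $\aleph_k^\bullet$, $\tilde{\cal T}^\bullet_{\tt D}$ and the restrictions be as in the context. Let $k$ be an integer with $1\le k\le N-1$ such that $$\phi^{k-1}-\phi^k>\phi^k-\phi^{k+1},$$ and let ${\tt Z}\in\aleph_k^\bullet$ be a labeled atom of $\mathfrak{A}_k$. Then $\tilde{\cal F}^k|_{\uparrow{\tt Z}}=\tilde{\cal F}^k|_{\tt Z}=\tilde{\cal T}^\bullet_{\tt Z}$. That is, for every $F\in\tilde{\cal F}^k$ we have $F|_{\uparrow{\tt Z}}=F|_{\tt Z}$ and this graph belongs to $\tilde{\cal T}^\bullet_{\tt Z}$; and for every $T\in\tilde{\cal T}^\bullet_{\tt Z}$ there exists $G\in\tilde{\cal F}^k$ with $G|_{\uparrow{\tt Z}}=G|_{\tt Z}=T$.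
   Context: $V$ is a directed graph without loops on a finite vertex set ${\tt N}$, $|{\tt N}|=N$; each arc $(i,j)$ has a real weight $v_{ij}$. It is assumed that $V$ has at least one spanning tree (in the sense below). An (entering) forest is a directed graph in which at most one arc leaves each vertex and there are no directed cycles; its connected components are trees, and the root of a tree is its unique vertex with no outgoing arc. All forests and trees considered are subgraphs of $V$. For a subgraph $G$ of $V$ and ${\tt D}\subseteq{\tt N}$ put $\Upsilon^G_{\tt D}=\sum_{i\in{\tt D},\,(i,j)\in G}v_{ij}$ (arcs whose tail lies in ${\tt D}$, the head may lie outside ${\tt D}$), and $\Upsilon^G=\Upsilon^G_{\tt N}$. ${\cal F}^j$ is the set of spanning forests of $V$ (vertex set ${\tt N}$) with exactly $j$ trees; $\phi^j=\min_{F\in{\cal F}^j}\Upsilon^F$, with $\phi^j=\infty$ if ${\cal F}^j=\emptyset$ (in particular $\phi^0=\infty$); $\tilde{\cal F}^j=\{F\in{\cal F}^j:\Upsilon^F=\phi^j\}$ (minimal forests). $\mathfrak{A}_k$ is the algebra of subsets of ${\tt N}$ generated (under complements and intersections) by the family of vertex sets of all trees of all forests in $\tilde{\cal F}^k$; an atom is a nonempty ${\tt A}\in\mathfrak{A}_k$ such that for every ${\tt B}\in\mathfrak{A}_k$ either ${\tt A}\cap{\tt B}=\emptyset$ or ${\tt A}\cap{\tt B}={\tt A}$; $\aleph_k$ is the set of atoms. An atom is labeled if it contains the root of some tree of some $F\in\tilde{\cal F}^k$; $\aleph_k^\bullet$ is the set of labeled atoms, $\aleph_k^\circ=\aleph_k\setminus\aleph_k^\bullet$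 the unlabeled ones. For ${\tt D}\subseteq{\tt N}$: ${\cal T}^\bullet_{\tt D}$ is the set of trees (subgraphs of $V$) with vertex set exactly ${\tt D}$, $\lambda^\bullet_{\tt D}=\min_{T\in{\cal T}^\bullet_{\tt D}}\Upsilon^T$, and $\tilde{\cal T}^\bullet_{\tt D}$ is the set of $T\in{\cal T}^\bullet_{\tt D}$ with $\Upsilon^T=\lambda^\bullet_{\tt D}$. For a graph $G$, $G|_{\tt D}$ is the induced subgraph on ${\tt D}$ (vertex set ${\tt D}$, all arcs of $G$ with both ends in ${\tt D}$). ${\tt N}^{out}_{\tt D}(G)$ is the set of heads $j\notin{\tt D}$ of arcs $(i,j)$ of $G$ with $i\in{\tt D}$. The outgoing restriction $G|_{\uparrow{\tt D}}$ is the graph whose arcs are exactly the arcs of $G$ with tail in ${\tt D}$ and whose vertex set is ${\tt D}\cup{\tt N}^{out}_{\tt D}(G)$. For a set ${\cal F}$ of graphs, ${\cal F}|_{\tt D}=\{F|_{\tt D}:F\in{\cal F}\}$ and ${\cal F}|_{\uparrow{\tt D}}=\{F|_{\uparrow{\tt D}}:F\in{\cal F}\}$. *)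

(* Defs.v *)
From mathcomp Require Import all_boot all_order all_algebra.
From mathcomp Require Import constructive_ereal reals.

Set Implicit Arguments.
Unset Strict Implicit.
Unset Printing Implicit Defensive.

Import Order.TTheory GRing.Theory Num.Theory.
Local Open Scope ring_scope.

(* A graph on vertices drawn from T is a pair (vertex set, arc set); the arc
   (i, j) goes from its tail i to its head j.  Equality of graphs compares
   both components. *)
Definition digraph (T : finType) : finType := ({set T} * {set T * T})%type.

Section Graphs.
Variable T : finType.
Implicit Types (G H F V : digraph T) (D : {set T}).

Definition verts G : {set T} := G.1.
Definition arcs G : {set T * T} := G.2.

Definition is_digraph G : bool :=
  [forall e in arcs G, [&& e.1 \in verts G, e.2 \in verts G & e.1 != e.2]].

Definition subgraph G V : bool :=
  [&& is_digraph G, verts G \subset verts V & arcs G \subset arcs V].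

Definition arc_rel G : rel T := fun x y => (x, y) \in arcs G.

(* A directed cycle (no repeated vertex) has at most #|T| vertices, so it is
   enough to range over nonempty tuples of length at most #|T|. *)
Definition acyclic G : bool :=
  [forall n : 'I_#|T|, forall c : n.+1.-tuple T, ~~ ucycleb (arc_rel G) c].

Definition out_neighbours G (x : T) : {set T} := [set y | (x, y) \in arcs G].

Definition is_forest G : bool :=
  [&& is_digraph G, [forall x, (#|out_neighbours G x| <= 1)%N] & acyclic G].

Definition adjacent G : rel T :=
  fun x y => ((x, y) \in arcs G) || ((y, x) \in arcs G).

(* Vertex sets of the (weakly) connected components. *)
Definition components G : {set {set T}} :=
  equivalence_partition (connect (adjacent G)) (verts G).

Definition is_tree G : bool := is_forest G && (#|components G| == 1)%N.

Definition is_root G (r : T) : bool :=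
  (r \in verts G) && (out_neighbours G r == set0).

Definition induced G D : digraph T :=
  (D, [set e in arcs G | (e.1 \in D) && (e.2 \in D)]).

Definition out_heads G D : {set T} :=
  [set j | (j \notin D) && [exists i in D, (i, j) \in arcs G]].

Definition out_restriction G D : digraph T :=
  (D :|: out_heads G D, [set e in arcs G | e.1 \in D]).

Definition trees_of F : {set digraph T} :=
  [set induced F C | C in components F].

Definition spanning_forests V (j : nat) : {set digraph T} :=
  [set F : digraph T |
    [&& subgraph F V, verts F == [set: T], is_forest F & #|trees_of F| == j]].

Definition trees_on V D : {set digraph T} :=
  [set G : digraph T | [&& subgraph G V, verts G == D & is_tree G]].

End Graphs.

Section Weights.
Variables (R : realType) (T : finType) (v : T -> T -> R).
Implicit Types (G V : digraph T) (D : {set T}) (S : {set digraph T}).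

Definition weight_on G D : R := \sum_(e in arcs G | e.1 \in D) v e.1 e.2.

Definition weight G : R := weight_on G [set: T].

Definition min_weight S : \bar R :=
  \big[Order.min/+oo%E]_(G in S) (weight G)%:E%E.

Definition phi V (j : nat) : \bar R := min_weight (spanning_forests V j).

Definition minimal_forests V (j : nat) : {set digraph T} :=
  [set F in spanning_forests V j | (weight F)%:E%E == phi V j].

Definition lambda_bullet V D : \bar R := min_weight (trees_on V D).

Definition minimal_trees_on V D : {set digraph T} :=
  [set G in trees_on V D | (weight G)%:E%E == lambda_bullet V D].

End Weights.

Section Atoms.
Variable T : finType.
Implicit Types (A S : {set {set T}}) (D : {set T}).

Definition is_set_algebra A : bool :=
  [&& [set: T] \in A, [forall B in A, ~: B \in A]
    & [forall B in A, forall C in A, B :&: C \in A]].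

Definition generated_algebra S : {set {set T}} :=
  \bigcap_(A : {set {set T}} | is_set_algebra A && (S \subset A)) A.

Definition atoms A : {set {set T}} :=
  [set D in A | (D != set0) &&
    [forall B in A, (D :&: B == set0) || (D :&: B == D)]].

End Atoms.

Section ForestAtoms.
Variables (R : realType) (T : finType) (v : T -> T -> R) (V : digraph T).

Definition tree_vertex_sets (k : nat) : {set {set T}} :=
  \bigcup_(F in minimal_forests v V k) [set verts H | H in trees_of F].

Definition forest_algebra (k : nat) : {set {set T}} :=
  generated_algebra (tree_vertex_sets k).

Definition labeled_atoms (k : nat) : {set {set T}} :=
  [set Z in atoms (forest_algebra k) |
    [exists F in minimal_forests v V k, exists H in trees_of F,
      exists r in Z, is_root H r]].

End ForestAtoms.

(* Main.v *)
Require Import Defs.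
From mathcomp Require Import all_boot all_order all_algebra.
From mathcomp Require Import constructive_ereal reals.

(* Let A and B be minimal forests with k trees and D the vertex set of a tree
   of A. No arc of A enters or leaves D, so exchanging the arcs of A and B with
   tails in D yields two forests. If B had no root in D these would have k - 1
   and k + 1 trees, against strict convexity; by counting, B has exactly one
   root in each tree of A, and the exchange preserves minimality.
   For a root r in the labeled atom Z, a smallest tree rooted at r among all
   minimal forests lies in the tree containing r of every minimal forest, hence
   is Z itself. Thus every minimal forest F has one root in Z. Exchanging the
   arcs with tails in Z between F and the forest having Z as a tree gives a
   minimal forest whose tree rooted in Z cannot exceed Z, but also contains Z
   since Z is an atom; so no arc of F leaves Z. Finally, trees on Z can be
   freely substituted for the restriction of F to Z. *)

Set Implicit Arguments.
Unset Strict Implicit.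
Unset Printing Implicit Defensive.

Import Order.TTheory GRing.Theory Num.Theory.

(** * Roots, basins and stable sets of an arc set *)

Section ArcSets.
Variable T : finType.
Implicit Types (A B : {set T * T}) (D : {set T}) (x y r : T).

Definition arrow A : rel T := fun x y => (x, y) \in A.

Definition roots A : {set T} := [set x | [forall y, (x, y) \notin A]].

Definition functional A : Prop :=
  forall x y z, (x, y) \in A -> (x, z) \in A -> y = z.

Definition rooted A : Prop :=
  forall x, exists2 r, r \in roots A & connect (arrow A) x r.

(* Acyclicity is encoded by reachability of a root, see [acyclicP]; unlike
   [is_forest], this does not mention the vertex set. *)
Definition forest A : Prop := functional A /\ rooted A.

(** In a forest with root [r], this is the vertex set of the tree rooted at [r]. *)
Definition basin A r : {set T} := [set x | connect (arrow A) x r].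

Definition stable A D : Prop :=
  forall x y, (x, y) \in A -> x \in D -> y \in D.

Lemma rootsP A x : reflect (forall y, (x, y) \notin A) (x \in roots A).
Proof. by rewrite inE; apply: forallP. Qed.

Lemma rootPn A x : x \notin roots A -> exists y, (x, y) \in A.
Proof.
rewrite inE negb_forall => /existsP[y]; rewrite negbK => xy; by exists y.
Qed.

Lemma connect_stable A D x y :
  stable A D -> connect (arrow A) x y -> x \in D -> y \in D.
Proof.
move=> sD /connectP[p + ->]; elim: p x => //= z p IHp x /andP[xz zp] xD.
exact/IHp/(sD _ _ xz).
Qed.

Lemma connect_root A r x :
  r \in roots A -> connect (arrow A) r x -> x = r.
Proof.
move=> /rootsP rA rx; apply/set1P/(connect_stable _ rx); last exact: set11.
by move=> a b ab /set1P ar; move: ab; rewrite ar (negPf (rA b)).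
Qed.

(** A path from [x] to [r] is nontrivial, as [r] has no outgoing arc, and by functionality it starts
    with the arc to [y]. So no arc crosses the boundary of a tree in either direction. *)
Lemma basin_arc A r x y : functional A -> r \in roots A ->
  (x, y) \in A -> (x \in basin A r) = (y \in basin A r).
Proof.
move=> fA /rootsP rA xy; rewrite !inE; apply/idP/idP; last first.
  exact/connect_trans/connect1.
case/connectP=> [[|z p]] /= => [_ rx|/andP[xz zp] ->].
  by rewrite -rx (negPf (rA y)) in xy.
by rewrite (fA _ _ _ xy xz); apply/connectP; exists p.
Qed.

Lemma mem_basin A r : r \in basin A r.
Proof. by rewrite inE connect0. Qed.

Lemma basin_stable A r : functional A -> r \in roots A -> stable A (basin A r).
Proof. by move=> fA rA x y xy; rewrite (basin_arc fA rA xy). Qed.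

Lemma basinC_stable A r :
  functional A -> r \in roots A -> stable A (~: basin A r).
Proof. by move=> fA rA x y xy; rewrite !(in_setC, basin_arc fA rA xy). Qed.

Lemma basin_unique A r s x : functional A -> r \in roots A -> s \in roots A ->
  x \in basin A r -> x \in basin A s -> r = s.
Proof.
move=> fA rA sA; rewrite [x \in basin A r]inE => xr xs.
have := connect_stable (basin_stable fA sA) xr xs.
by rewrite inE => /(connect_root rA).
Qed.

Lemma basin_sub A D r : (forall x y, (x, y) \in A -> x \in D) ->
  r \in D -> basin A r \subset D.
Proof.
move=> AD rD; apply/subsetP => x; rewrite inE => /connectP[[|y p]] /=.
  by move=> _ <-.
by case/andP=> /AD.
Qed.

(** * Forests, components and trees in terms of roots and reachability *)

Lemma acyclicP D A : functional A -> reflect (rooted A) (acyclic (D, A)).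
Proof.
move=> fA; apply: (iffP forallP) => [acA|rA n]; last first.
  apply/forallP => c; apply/negP => /andP[cycA _].
  have c_arc y : y \in c -> (y, next c y) \in A := next_cycle cycA.
  (* Functionality traps paths on the cycle, and no vertex of a cycle is a root. *)
  have c_stable : stable A [set y in c].
    move=> x y xy; rewrite !inE => xc.
    by rewrite (fA _ _ _ xy (c_arc _ xc)) mem_next.
  have [r /rootsP rA' xr] := rA (thead c).
  have := connect_stable c_stable xr; rewrite !inE mem_tnth => /(_ isT) rc.
  by move: (rA' (next c r)); rewrite c_arc.
move=> x.
have [n] := ubnP #|connect (arrow A) x|; elim: n x => // n IHn x le_xn.
have [xA|/rootPn[y xy]] := boolP (x \in roots A); first by exists x.
(* A repetition-free path from [y] back to [x] would close a cycle. Hence [y] reaches strictly fewer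
   vertices than [x], which drives the induction. *)
have nyx : ~~ connect (arrow A) y x.
  apply/negP => /connectP[p0 p0P def_x].
  move: xy; rewrite {x le_xn}def_x; case/shortenP: p0P => p yp up _ xy.
  have lt_p : size p < #|T|.
    by move/card_uniqP: up => /= <-; apply: max_card.
  have /forallP/(_ (in_tuple (y :: p)))/negP := acA (Ordinal lt_p).
  by case; apply/andP; split=> //=; rewrite rcons_path; apply/andP.
have [|r rA yr] := IHn y; last first.
  by exists r => //; apply: connect_trans yr; apply: connect1.
rewrite ltnS in le_xn; apply: leq_trans le_xn; apply/proper_card/properP; split.
  by apply/subsetP => z; apply: connect_trans; apply: connect1.
by exists x => //; apply: connect0.
Qed.

Lemma is_forestP D A :
  reflect (is_digraph (D, A) /\ forest A) (is_forest (D, A)).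
Proof.
have deg1P : reflect (functional A) [forall x, #|out_neighbours (D, A) x| <= 1].
  apply: (iffP forallP) => [dA x y z xy xz|fA x].
    by apply: (card_le1_eqP (dA x)); rewrite inE.
  by apply/card_le1_eqP => y z; rewrite !inE => xy xz; apply: fA xz xy.
apply: (iffP and3P) => [[dA /deg1P fA /(acyclicP _ fA) rA]|[dA [fA rA]]] //.
by split=> //; [exact/deg1P|exact/acyclicP].
Qed.

Lemma connect_adjacent D A r x : functional A -> r \in roots A ->
  connect (adjacent (D, A)) r x = (x \in basin A r).
Proof.
move=> fA rA; have adj_sym : connect_sym (adjacent (D, A)).
  by apply: sym_connect_sym => y z; rewrite /adjacent orbC.
apply/idP/idP => [rx|].
  have cl : closed (adjacent (D, A)) (mem (basin A r)).
    by move=> y z /orP[] /(basin_arc fA rA) ->.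
  by rewrite -(closed_connect cl rx) mem_basin.
rewrite inE adj_sym; apply: connect_sub => y z yz; apply: connect1.
by rewrite /adjacent [X in X || _]yz.
Qed.

Lemma components_forest D A :
  (forall x y, (x, y) \in A -> (x \in D) && (y \in D)) -> forest A ->
  components (D, A) = [set basin A r | r in roots A :&: D].
Proof.
move=> AD [fA rA]; have AD1 x y : (x, y) \in A -> x \in D by case/AD/andP.
have adj_sym : connect_sym (adjacent (D, A)).
  by apply: sym_connect_sym => y z; rewrite /adjacent orbC.
have basinE r : r \in roots A -> r \in D ->
    [set y in D | connect (adjacent (D, A)) r y] = basin A r.
  move=> rA' rD; apply/setP => y; rewrite inE connect_adjacent //.
  by apply: andb_idl; apply/subsetP: y; apply: basin_sub.
apply/setP => C; apply/imsetP/imsetP => [[x xD ->]|[r /setIP[rA' rD] ->]].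
  have [r rA' xr] := rA x.
  have rD : r \in D by apply: connect_stable xr xD => y z /AD/andP[].
  exists r; first by rewrite inE rA'.
  rewrite -basinE //; apply/setP => y; rewrite !inE; congr (_ && _).
  by apply: same_connect; rewrite // adj_sym connect_adjacent // inE.
by exists r; rewrite ?basinE.
Qed.

Lemma card_components D A :
  (forall x y, (x, y) \in A -> (x \in D) && (y \in D)) -> forest A ->
  #|components (D, A)| = #|roots A :&: D|.
Proof.
move=> AD forA; rewrite components_forest // card_in_imset // => r s.
move=> /setIP[rA _] /setIP[sA _] eq_rs.
by apply: (@basin_unique _ _ _ r forA.1) => //; rewrite -?eq_rs mem_basin.
Qed.

Lemma subgraphP V D A : is_digraph V -> verts V = [set: T] ->
  reflect (A \subset arcs V /\
           forall x y, (x, y) \in A -> (x \in D) && (y \in D))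
    (subgraph (D, A) V).
Proof.
move=> /forallP dV vV; rewrite /subgraph vV subsetT /=.
apply: (iffP andP) => [[/forallP dA sA]|[sA AD]]; split=> //.
  by move=> x y xy; have /implyP/(_ xy)/and3P[-> ->] := dA (x, y).
apply/forallP => -[x y]; apply/implyP => /= xy; rewrite andbA AD //=.
by have /implyP/(_ (subsetP sA _ xy))/and3P[] := dV (x, y).
Qed.

Lemma spanning_forestsP V j A : is_digraph V -> verts V = [set: T] ->
  reflect [/\ A \subset arcs V, forest A & #|roots A| = j]
    (([set: T], A) \in spanning_forests V j).
Proof.
move=> dV vV; rewrite inE /= eqxx andTb /trees_of card_imset; last first.
  by move=> C D [].
have ATT x y : (x, y) \in A -> (x \in [set: T]) && (y \in [set: T]).
  by rewrite !inE.
apply: (iffP and3P).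
  move=> [/(subgraphP _ _ dV vV)[sA _] /is_forestP[_ forA] +].
  by rewrite card_components // setIT => /eqP.
move=> [sA forA rA]; have sAV : subgraph ([set: T], A) V by apply/subgraphP.
split=> //; first by apply/is_forestP; case/and3P: sAV.
by rewrite card_components // setIT rA.
Qed.

Lemma spanning_forest_arcs V j F :
  F \in spanning_forests V j -> F = ([set: T], arcs F).
Proof. by rewrite inE => /and4P[_ /eqP <- _ _]; case: F. Qed.

(** Vertices outside [D] have no outgoing arc and so belong to [roots A]; intersecting with [D]
    discards them. *)
Lemma trees_onP V D A : is_digraph V -> verts V = [set: T] ->
  reflect [/\ A \subset arcs V,
    forall x y, (x, y) \in A -> (x \in D) && (y \in D),
    forest A & #|roots A :&: D| = 1]
    ((D, A) \in trees_on V D).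
Proof.
move=> dV vV; rewrite inE eqxx andTb /is_tree; apply: (iffP and3P).
  move=> [/(subgraphP _ _ dV vV)[sA AD] /is_forestP[_ forA] +].
  by rewrite card_components // => /eqP.
move=> [sA AD forA rA]; have sAV : subgraph (D, A) V by apply/subgraphP.
split=> //; first by apply/is_forestP; case/and3P: sAV.
by rewrite card_components // rA.
Qed.

Lemma trees_on_arcs V D F : F \in trees_on V D -> F = (D, arcs F).
Proof. by rewrite inE => /and3P[_ /eqP <- _]; case: F. Qed.

(** * Exchanging the arcs of two arc sets over a set of tails *)

Definition graft D A B : {set T * T} :=
  [set e in A | e.1 \in D] :|: [set e in B | e.1 \notin D].

Lemma in_graft D A B x y :
  ((x, y) \in graft D A B) = (if x \in D then (x, y) \in A else (x, y) \in B).
Proof.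
by rewrite !inE; case: (x \in D); rewrite /= ?andbT ?andbF ?orbF ?orbT.
Qed.

Lemma graftC D A B : graft (~: D) A B = graft D B A.
Proof. by apply/setP => -[x y]; rewrite !in_graft inE if_neg. Qed.

Lemma graft_sub D A B (E : {set T * T}) :
  A \subset E -> B \subset E -> graft D A B \subset E.
Proof.
move=> /subsetP sA /subsetP sB; apply/subsetP => -[x y].
by rewrite in_graft; case: ifP => _; [apply: sA|apply: sB].
Qed.

Lemma roots_graft D A B x :
  (x \in roots (graft D A B)) = (x \in roots (if x \in D then A else B)).
Proof.
rewrite ![_ \in roots _]inE; apply: eq_forallb => y.
by rewrite in_graft; case: ifP.
Qed.

Lemma card_roots_graft D A B :
  #|roots (graft D A B)| = #|roots A :&: D| + #|roots B :\: D|.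
Proof.
rewrite -(cardsID D); congr (_ + _); apply: eq_card => x.
  by rewrite in_setI roots_graft in_setI; case: (x \in D); rewrite ?andbF.
by rewrite in_setD roots_graft in_setD; case: (x \in D).
Qed.

(* An [A]-path started in the [A]-stable set [D] survives in the graft, and a
   [B]-path either avoids [D] or enters it. *)
Lemma graft_forest D A B :
  stable A D -> forest A -> forest B -> forest (graft D A B).
Proof.
move=> sD [fA rA] [fB rB]; split=> [x y z|].
  by rewrite !in_graft; case: ifP => _; [apply: fA|apply: fB].
have rootedD x : x \in D ->
    exists2 r, r \in roots (graft D A B) & connect (arrow (graft D A B)) x r.
  move=> xD; have [r rA' xr] := rA x.
  exists r; first by rewrite roots_graft (connect_stable sD xr).
  case/connectP: xr => p; elim: p x xD => [|y p IHp] x xD /= => [_ ->|] //.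
  move=> /andP[xy yp] def_r; apply: connect_trans (IHp y _ yp def_r).
    by apply: connect1; rewrite /arrow in_graft xD.
  exact: sD xy xD.
move=> x; have [r rB' /connectP[p]] := rB x.
elim: p x => [|y p IHp] x /=; have [/rootedD //|xD] := boolP (x \in D).
  by move=> _ def_r; exists r; rewrite ?roots_graft def_r // (negPf xD) -def_r.
move=> /andP[xy yp] def_r; have [s sG ys] := IHp y yp def_r.
exists s => //; apply: connect_trans ys; apply: connect1.
by rewrite /arrow in_graft (negPf xD).
Qed.

(** Arcs of [B] starting outside [D] never enter [D], so a path of the graft that ends in [D] stays
    in [D] throughout and uses arcs of [A] only. *)
Lemma basin_graft D A B r : stable B (~: D) -> r \in D ->
  basin (graft D A B) r \subset D :&: basin A r.
Proof.
move=> sD rD; apply/subsetP => x; rewrite !inE => /connectP[p].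
elim: p x => [|y p IHp] x /= => [_ <-|/andP[xy yp] def_r].
  by rewrite rD connect0.
have /andP[yD yr] := IHp y yp def_r; move: xy; rewrite /arrow in_graft.
case: ifPn => xD xy; first exact: connect_trans (connect1 _) yr.
by have := sD _ _ xy; rewrite !inE xD yD => /(_ isT).
Qed.

End ArcSets.

(** * Weights of grafts *)

Section MinimalForests.
Local Open Scope ring_scope.
Variables (R : realType) (T : finType) (v : T -> T -> R).
Implicit Types (A B H : {set T * T}) (D X Y : {set T}) (r s x y : T).

Lemma min_weightP (S : {set digraph T}) G : G \in S ->
  reflect (forall G', G' \in S -> weight v G <= weight v G')
    ((weight v G)%:E == min_weight v S)%E.
Proof.
move=> GS; apply: (iffP eqP) => [minG G' G'S|minG].
  by rewrite -lee_fin minG; apply: bigmin_le_cond.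
apply/le_anti/andP; split; last exact: bigmin_le_cond.
by apply: le_bigmin => [|G' G'S]; rewrite ?leey // lee_fin minG.
Qed.

Lemma weight_split D X A :
  weight v (X, A) = weight_on v (X, A) D + weight_on v (X, A) (~: D).
Proof.
rewrite /weight {1}/weight_on (bigID (fun e : T * T => e.1 \in D)) /=.
by congr (_ + _); apply: eq_bigl => e; rewrite !inE andbT.
Qed.

Lemma weight_graft D X A B :
  weight v (X, graft D A B) =
    weight_on v (X, A) D + weight_on v (X, B) (~: D).
Proof.
rewrite (weight_split D); congr (_ + _); apply: eq_bigl => -[x y] /=.
  by rewrite in_graft; case: (x \in D); rewrite ?andbF.
by rewrite in_graft inE; case: (x \in D); rewrite ?andbF.
Qed.

Lemma weight_graft_exchange D X A B :
  weight v (X, graft D A B) + weight v (X, graft D B A) =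
    weight v (X, A) + weight v (X, B).
Proof.
rewrite !weight_graft (weight_split D X A) (weight_split D X B).
by rewrite addrACA [RHS]addrACA; congr (_ + _); apply: addrC.
Qed.

(** * Exchanges between minimal forests under strict convexity *)

Variables (V : digraph T) (k : nat).
Hypotheses (dV : is_digraph V) (vV : verts V = [set: T]).
Hypothesis strictly_convex :
  (phi v V k - phi v V (k + 1) < phi v V (k - 1) - phi v V k)%E.

Local Notation span j A := (([set: T], A) \in spanning_forests V j).
Local Notation minimal A := (([set: T], A) \in minimal_forests v V k).
Local Notation wt A := (weight v ([set: T], A)).

Lemma minimal_forestsP A :
  reflect (span k A /\ forall B, span k B -> wt A <= wt B) (minimal A).
Proof.
apply: (iffP setIdP) => -[sA minA]; split=> //.
  by move=> B; move/(min_weightP sA): minA; apply.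
apply/(min_weightP sA) => G sG.
by rewrite (spanning_forest_arcs sG) minA // -(spanning_forest_arcs sG).
Qed.

Lemma minimal_phi A : minimal A -> phi v V k = (wt A)%:E.
Proof. by rewrite inE => /andP[_ /eqP]. Qed.

Lemma minimalE A :
  minimal A -> [/\ A \subset arcs V, forest A & #|roots A| = k].
Proof. by case/minimal_forestsP=> /(spanning_forestsP _ _ dV vV). Qed.

(** The weights of [P] and [Q] bound [phi] at [k - 1] and [k + 1] from above, so strict convexity
    passes from the minima to actual forests. *)
Lemma strict_exchange A B P Q : minimal A -> minimal B ->
  span (k - 1) P -> span (k + 1) Q -> wt A + wt B < wt P + wt Q.
Proof.
move=> mA mB sP sQ; move: strictly_convex.
rewrite {1}(minimal_phi mA) (minimal_phi mB) => convex.
have leP : (phi v V (k - 1) <= (wt P)%:E)%E by apply: bigmin_le_cond.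
have leQ : (phi v V (k + 1) <= (wt Q)%:E)%E by apply: bigmin_le_cond.
have := le_lt_trans (leeB (lexx _) leQ) (lt_le_trans convex (leeB leP (lexx _))).
by rewrite -!EFinB lte_fin ltrBlDr addrAC ltrBrDr.
Qed.

Lemma graft_spanning i j D A B : span i A -> span j B -> stable A D ->
  span (#|roots A :&: D| + #|roots B :\: D|)%N (graft D A B).
Proof.
move=> /(spanning_forestsP _ _ dV vV)[sA fA _].
move=> /(spanning_forestsP _ _ dV vV)[sB fB _] sD.
apply/spanning_forestsP=> //; split; first exact: graft_sub.
  exact: graft_forest.
exact: card_roots_graft.
Qed.

Lemma graftC_spanning i j D A B : span i A -> span j B -> stable A (~: D) ->
  span (#|roots A :\: D| + #|roots B :&: D|)%N (graft D B A).
Proof.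
move=> sA sB sD; have := graft_spanning sA sB sD.
by rewrite graftC -setDE [_ :\: ~: D]setDE setCK.
Qed.

Lemma roots_basin A r : forest A -> r \in roots A ->
  roots A :&: basin A r = [set r].
Proof.
move=> [fA _] rA; apply/setP => x; rewrite in_setI in_set1.
apply/andP/eqP => [[xA xr]|->]; last by rewrite mem_basin.
exact: basin_unique fA xA rA (mem_basin _ _) xr.
Qed.

Lemma card_rootsD A r : minimal A -> r \in roots A ->
  #|roots A :\: basin A r| = (k - 1)%N.
Proof.
move=> mA rA; have [_ fA <-] := minimalE mA.
by rewrite -(cardsID (basin A r) (roots A)) roots_basin // cards1 add1n subn1.
Qed.

Lemma minimal_spanning A : minimal A -> span k A.
Proof. by case/minimal_forestsP. Qed.

(** Otherwise the two exchanges over [basin A r] would have [k + 1] and [k - 1] roots and the same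
    total weight as [A] and [B], against [strict_exchange]. *)
Lemma basin_root_exists A B r : minimal A -> minimal B -> r \in roots A ->
  (0 < #|roots B :&: basin A r|)%N.
Proof.
move=> mA mB rA; rewrite lt0n; apply/negP => /eqP noB.
have [_ fA _] := minimalE mA; have [_ _ cB] := minimalE mB.
have [sA sB] := (minimal_spanning mA, minimal_spanning mB).
have := graft_spanning sA sB (basin_stable fA.1 rA).
have := graftC_spanning sA sB (basinC_stable fA.1 rA).
have := cardsID (basin A r) (roots B).
rewrite noB cB add0n => ->; rewrite roots_basin // cards1 card_rootsD //.
rewrite addn0 addnC => sP sQ.
have := strict_exchange mA mB sP sQ.
by rewrite addrC weight_graft_exchange addrC ltxx.
Qed.

(* The map sending a root of [B] to the root of its tree in [A] is onto by
   [basin_root_exists], and both forests have [k] roots, so it is injective. *)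
Lemma basin_root_unique A B r : minimal A -> minimal B -> r \in roots A ->
  #|roots B :&: basin A r| = 1%N.
Proof.
move=> mA mB rA; have [_ [fA rootedA] cA] := minimalE mA.
have [_ _ cB] := minimalE mB.
(* Since [A] is rooted, every [x] lies in some basin and the default is never taken. *)
pose f x := odflt x [pick s in roots A | x \in basin A s].
have fE x s : s \in roots A -> x \in basin A s -> f x = s.
  move=> sA xs; rewrite /f; case: pickP => [t /andP[tA xt]|/(_ s)] /=.
    exact: basin_unique fA tA sA xt xs.
  by rewrite sA xs.
have f_inj : {in roots B &, injective f}.
  apply/imset_injP; rewrite eqn_leq leq_imset_card cB -cA subset_leq_card //.
  apply/subsetP => s sA; have := basin_root_exists mA mB sA.
  case/card_gt0P=> x /setIP[xB xs]; apply/imsetP; exists x => //.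
  by rewrite (fE x s).
apply/eqP; rewrite eqn_leq basin_root_exists // andbT.
apply/card_le1_eqP => x y /setIP[xB xr] /setIP[yB yr].
by apply/esym/f_inj => //; rewrite (fE _ r) ?(fE _ r).
Qed.

(** Both exchanges keep [k] roots. The opposite graft weighs at least as much as [B], so, the total
    being preserved, this one weighs at most as much as [A]. *)
Lemma graft_minimal A B r : minimal A -> minimal B -> r \in roots A ->
  minimal (graft (basin A r) B A).
Proof.
move=> mA mB rA.
have [_ fA _] := minimalE mA; have [_ _ cB] := minimalE mB.
have [sA minA] := minimal_forestsP _ mA.
have [sB minB] := minimal_forestsP _ mB.
(* Subtraction is truncated: [k - 1 + 1 = k] needs a positive [k], which the root [r] provides. *)
have k_gt0 : (0 < k)%N by have [_ _ <-] := minimalE mA; apply/card_gt0P; exists r.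
have := graft_spanning sA sB (basin_stable fA.1 rA).
have := graftC_spanning sA sB (basinC_stable fA.1 rA).
have := cardsID (basin A r) (roots B).
rewrite basin_root_unique // cB roots_basin // cards1 card_rootsD // => ->.
rewrite subnK // => sG sG'.
apply/minimal_forestsP; split=> // C sC; apply: le_trans (minA _ sC).
rewrite -(lerD2l (wt (graft (basin A r) A B))) weight_graft_exchange addrC.
by rewrite lerD2r minB.
Qed.

(** * Labeled atoms of the forest algebra *)

Lemma tree_vertex_setsP D :
  reflect (exists A r, [/\ minimal A, r \in roots A & D = basin A r])
    (D \in tree_vertex_sets v V k).
Proof.
have trees_vertsE F : [set verts H | H in trees_of F] = components F.
  by rewrite -imset_comp /= imset_id.
have componentsE A : minimal A ->
    components ([set: T], A) = [set basin A r | r in roots A].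
  move=> /minimalE[_ fA _]; rewrite components_forest ?setIT // => x y _.
  by rewrite !inE.
apply: (iffP bigcupP) => [[F mF]|[A [r [mA rA ->]]]]; last first.
  by exists ([set: T], A); rewrite // trees_vertsE componentsE // imset_f.
have FE : F = ([set: T], arcs F).
  by case/setIdP: mF => /spanning_forest_arcs.
rewrite FE in mF *; rewrite trees_vertsE componentsE // => /imsetP[r rF ->].
by exists (arcs F), r.
Qed.

(** A root of a component is a root of the whole forest: an arc leaving it would stay in the
    component and thus belong to the induced tree. *)
Lemma labeled_atom_root Z : Z \in labeled_atoms v V k ->
  exists A r, [/\ minimal A, r \in roots A & r \in Z].
Proof.
case/setIdP=> _ /existsP[F /andP[mF /existsP[H /andP[]]]].
have FE : F = ([set: T], arcs F).
  by case/setIdP: mF => /spanning_forest_arcs.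
rewrite FE in mF *; move: (arcs F) mF => A mA {F FE}.
move=> /imsetP[C C_A ->] /existsP[r /andP[rZ /andP[/= rC /eqP out_r]]].
exists A, r; split=> //; have [_ fA _] := minimalE mA.
move: C_A rC out_r; rewrite components_forest //; last first.
  by move=> x y _; rewrite !inE.
case/imsetP=> s /setIP[sA _] -> rs out_r; apply/rootsP => y.
apply/negP => ry; have : y \in set0; last by rewrite inE.
rewrite -out_r in_set in_set; apply/and3P; split=> //=.
by rewrite -(basin_arc fA.1 sA ry).
Qed.

Lemma atom_sub_basin Z A r x : Z \in labeled_atoms v V k ->
  minimal A -> r \in roots A -> x \in Z -> x \in basin A r ->
  Z \subset basin A r.
Proof.
case/setIdP=> /setIdP[_ /andP[_ /forallP/(_ (basin A r))/implyP atomZ]] _.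
move=> mA rA xZ xr; have /atomZ : basin A r \in forest_algebra v V k.
  apply/bigcapP => S /andP[_ /subsetP]; apply.
  by apply/tree_vertex_setsP; exists A, r.
case/orP=> /eqP; last by move/setIidPl.
by move/setP/(_ x); rewrite in_setI in_set0 xZ xr.
Qed.

Lemma mem_generated_algebra (S S' : {set {set T}}) D :
  is_set_algebra S' -> S \subset S' -> D \in generated_algebra S -> D \in S'.
Proof. by move=> algS' sS /bigcapP; apply; rewrite algS'. Qed.

(** With [mem_generated_algebra], this reduces the claim that no set of a generated algebra cuts [X]
    to a check on the generators. *)
Lemma indivisible_set_algebra X :
  is_set_algebra [set B : {set T} | (X \subset B) || [disjoint X & B]].
Proof.
apply/and3P; split; first by rewrite inE subsetT.
  apply/forallP => B; rewrite !inE; apply/implyP => XB.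
  by rewrite disjoints_subset setCK orbC -disjoints_subset.
apply/forallP => B; apply/implyP; rewrite inE => XB.
apply/forallP => C; apply/implyP; rewrite !inE subsetI => XC.
case/orP: XB => [->|dB]; last first.
  by rewrite (disjointWr (subsetIl B C) dB) orbT.
case/orP: XC => [->|dC] //.
by rewrite (disjointWr (subsetIr B C) dC) orbT.
Qed.

(* The smallest tree rooted at [r] among all minimal forests lies in the tree
   of [r] in any minimal forest [F]: grafting [H] onto that tree of [F]
   gives a minimal forest in which the tree of [r] lies in both. *)
Lemma labeled_atom_basin Z A r : Z \in labeled_atoms v V k ->
  minimal A -> r \in roots A -> r \in Z ->
  exists2 H, minimal H & r \in roots H /\ Z = basin H r.
Proof.
move=> atZ mA rA rZ.
pose P (H : {set T * T}) := minimal H && (r \in roots H).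
have PA : P A by rewrite /P mA.
case: (arg_minnP (fun H => #|basin H r|) PA) => H /andP[mH rH] minH.
have sub_tree F s : minimal F -> s \in roots F -> r \in basin F s ->
    basin H r \subset basin F s.
  move=> mF sF rs; have [_ [fF _] _] := minimalE mF.
  have rG : r \in roots (graft (basin F s) H F) by rewrite roots_graft rs.
  have := basin_graft H (basinC_stable fF sF) rs; rewrite subsetI.
  case/andP=> subF subH; apply: subset_trans subF.
  rewrite (_ : basin H r = basin (graft (basin F s) H F) r) //.
  apply/esym/eqP; rewrite eqEcard subH minH // /P rG andbT.
  exact: graft_minimal.
exists H => //; split=> //; apply/eqP; rewrite eqEsubset.
rewrite (atom_sub_basin atZ mH rH rZ) ?mem_basin //=.
(* Reverse inclusion: no tree of a minimal forest cuts [basin H r], hence neither does [Z], and both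
   contain [r]. *)
have : Z \in [set B : {set T} | (basin H r \subset B) || [disjoint basin H r & B]].
  have /setIdP[/setIdP[algZ _] _] := atZ.
  apply: mem_generated_algebra (indivisible_set_algebra _) _ algZ.
  apply/subsetP => B /tree_vertex_setsP[F [s [mF sF ->]]]; rewrite inE.
  have [_ [fF rF] _] := minimalE mF; have [t tF rt] := rF r.
  have {}rt : r \in basin F t by rewrite inE.
  have subt := sub_tree F t mF tF rt.
  have [<-|ne_ts] := eqVneq t s; first by rewrite subt.
  rewrite disjoint_subset; apply/orP; right; apply/subsetP => x /(subsetP subt).
  move=> xt; apply: contra ne_ts => xs; apply/eqP.
  exact: basin_unique fF tF sF xt xs.
rewrite inE => /orP[//|/pred0P/(_ r)/=]; by rewrite rZ mem_basin.
Qed.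

Lemma labeled_atom_stable Z A : Z \in labeled_atoms v V k -> minimal A ->
  stable A Z /\ #|roots A :&: Z| = 1%N.
Proof.
move=> atZ mA; have [B [r [mB rB rZ]]] := labeled_atom_root atZ.
have [H mH [rH ZE]] := labeled_atom_basin atZ mB rB rZ.
have cZ : #|roots A :&: Z| = 1%N by rewrite ZE basin_root_unique.
split=> // x y xy xZ.
have /card_gt0P[s /setIP[sA sZ]] : (0 < #|roots A :&: Z|)%N by rewrite cZ.
have [_ [fH _] _] := minimalE mH.
have mG : minimal (graft Z A H) by rewrite ZE graft_minimal.
have sG : s \in roots (graft Z A H) by rewrite roots_graft sZ.
have [_ [fG _] _] := minimalE mG.
(* As an atom, [Z] lies in the tree of [s] in the graft; that tree lies in [Z] because no arc of [H]
   enters [Z]. The arc from [x] to [y] belongs to the graft, so [y] is in this tree. *)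
have /subsetP subG := atom_sub_basin atZ mG sG sZ (mem_basin _ _).
have sZC : stable H (~: Z) by rewrite ZE; apply: basinC_stable.
have := basin_graft A sZC sZ; rewrite subsetI => /andP[/subsetP GZ _].
by apply: GZ; rewrite -(basin_arc fG sG (x := x)) ?in_graft ?xZ // subG.
Qed.

(** * Restriction to a labeled atom and substitution of trees *)

Lemma induced_stable D A :
  stable A D -> induced ([set: T], A) D = (D, graft D A set0).
Proof.
move=> sD; congr (_, _); apply/setP => -[x y]; rewrite in_graft !inE /=.
case: ifP => xD; rewrite ?andbF //=; apply: andb_idr => xy; exact: sD xy xD.
Qed.

(** Stability leaves no heads outside [D], so both restrictions are the same graph, whose arcs are
    encoded as a graft with the empty arc set. *)
Lemma out_restriction_stable D A :
  stable A D -> out_restriction ([set: T], A) D = (D, graft D A set0).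
Proof.
move=> sD; congr (_, _).
  apply/setUidPl/subsetP => y; rewrite inE => /andP[_ /existsP[x /andP[xD xy]]].
  exact: sD xy xD.
by apply/setP => -[x y]; rewrite in_graft !inE andbC; case: ifP.
Qed.

Lemma forest_set0 : @forest T set0.
Proof.
split=> [x y z|x]; first by rewrite inE.
by exists x; rewrite ?connect0 //; apply/rootsP => y; rewrite inE.
Qed.

Lemma restriction_tree Z A : Z \in labeled_atoms v V k -> minimal A ->
  (Z, graft Z A set0) \in trees_on V Z.
Proof.
move=> atZ mA; have [sZ cZ] := labeled_atom_stable atZ mA.
have [sA fA _] := minimalE mA; apply/trees_onP=> //; split.
- by rewrite graft_sub ?sub0set.
- move=> x y; rewrite in_graft; case: ifP; rewrite ?inE // => xZ xy.
  by rewrite (sZ _ _ xy xZ).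
- exact: graft_forest sZ fA forest_set0.
- rewrite -cZ; apply: eq_card => x; rewrite !in_setI roots_graft.
  by case: (x \in Z); rewrite ?andbF.
Qed.

(** The single root of [B] in [Z] replaces the single root of [A] there, so the number of roots
    stays [k]. *)
Lemma graft_tree Z A B : Z \in labeled_atoms v V k -> minimal A ->
  (Z, B) \in trees_on V Z ->
  span k (graft Z B A) /\
  wt (graft Z B A) = weight v (Z, B) + weight_on v ([set: T], A) (~: Z).
Proof.
move=> atZ mA /(trees_onP _ _ dV vV)[sB BZ fB rB].
have [_ cZ] := labeled_atom_stable atZ mA; have [sA fA cA] := minimalE mA.
split.
  apply/spanning_forestsP=> //; split; first exact: graft_sub.
    by apply: graft_forest => // x y /BZ/andP[].
  by rewrite card_roots_graft rB -cZ cardsID.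
rewrite weight_graft; congr (_ + _); apply: eq_bigl => -[x y] /=.
by rewrite inE; apply: andb_id2l => /BZ/andP[->].
Qed.

(** Grafting the restriction of [A] back onto [A] restores [A], so [graft_tree] applies. *)
Lemma weight_restriction Z A : Z \in labeled_atoms v V k -> minimal A ->
  wt A = weight v (Z, graft Z A set0) + weight_on v ([set: T], A) (~: Z).
Proof.
move=> atZ mA; have [_ <-] := graft_tree atZ mA (restriction_tree atZ mA).
congr (weight v (_, _)); apply/setP => -[x y]; rewrite !in_graft.
by case: (x \in Z).
Qed.

(** Any other tree on [Z] can be substituted, giving a spanning forest with [k] trees; the weight
    outside [Z] is common to both and cancels. *)
Lemma restriction_minimal_tree Z A : Z \in labeled_atoms v V k -> minimal A ->
  (Z, graft Z A set0) \in minimal_trees_on v V Z.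
Proof.
move=> atZ mA; have tA := restriction_tree atZ mA.
apply/setIdP; split=> //; apply/(min_weightP tA) => G tG.
have GE := trees_on_arcs tG; rewrite GE in tG *.
have [sG wG] := graft_tree atZ mA tG.
rewrite -(lerD2r (weight_on v ([set: T], A) (~: Z))) -wG.
by rewrite -weight_restriction //; have [_ ->] := minimal_forestsP _ mA.
Qed.

(** Grafted onto any minimal forest, [B] weighs at most as much as the restriction it replaces, so
    the result is still minimal. *)
Lemma minimal_tree_extends Z B : Z \in labeled_atoms v V k ->
  (Z, B) \in minimal_trees_on v V Z ->
  exists2 A, minimal A & graft Z A set0 = B.
Proof.
move=> atZ /setIdP[tB minB]; have [A [_ [mA _ _]]] := labeled_atom_root atZ.
have [sG wG] := graft_tree atZ mA tB; exists (graft Z B A).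
  apply/minimal_forestsP; split=> // C sC.
  have [_ minA] := minimal_forestsP _ mA; apply: le_trans (minA _ sC).
  rewrite wG (weight_restriction atZ mA) lerD2r.
  by move/(min_weightP tB): minB; apply; apply: restriction_tree.
have [_ BZ _ _] := trees_onP _ _ dV vV tB.
apply/setP => -[x y]; rewrite !in_graft inE; case: (boolP (x \in Z)) => // xZ.
by apply/esym/negP => /BZ; rewrite (negPf xZ).
Qed.

End MinimalForests.

(** * Return from arc sets to digraphs *)

Theorem theorem1 (R : realType) (T : finType) (V : digraph T)
    (v : T -> T -> R) (k : nat) (Z : {set T}) :
  is_digraph V ->
  verts V = [set: T] ->
  trees_on V [set: T] != set0 ->
  (1 <= k <= #|T| - 1)%N ->
  (phi v V (k - 1) - phi v V k > phi v V k - phi v V (k + 1))%E ->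
  Z \in labeled_atoms v V k ->
  [/\ [set out_restriction F Z | F in minimal_forests v V k] =
        [set induced F Z | F in minimal_forests v V k],
      [set induced F Z | F in minimal_forests v V k] = minimal_trees_on v V Z,
      (forall F : digraph T, F \in minimal_forests v V k ->
        out_restriction F Z = induced F Z /\
        induced F Z \in minimal_trees_on v V Z)
    & (forall H : digraph T, H \in minimal_trees_on v V Z ->
        exists G : digraph T,
          [/\ G \in minimal_forests v V k,
              out_restriction G Z = induced G Z & induced G Z = H])].
Proof.
move=> dV vV _ _ convex atZ.
have minE F : F \in minimal_forests v V k -> F = ([set: T], arcs F).
  by case/setIdP=> /spanning_forest_arcs.
have restr F : F \in minimal_forests v V k ->
    out_restriction F Z = induced F Z /\ induced F Z \in minimal_trees_on v V Z.
  move=> mF; have FE := minE F mF; rewrite FE in mF *.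
  have [sZ _] := labeled_atom_stable dV vV convex atZ mF.
  rewrite induced_stable // out_restriction_stable //; split=> //.
  exact: (restriction_minimal_tree dV vV convex).
have extend H : H \in minimal_trees_on v V Z -> exists G : digraph T,
    [/\ G \in minimal_forests v V k,
        out_restriction G Z = induced G Z & induced G Z = H].
  move=> mH; have HE : H = (Z, arcs H).
    by case/setIdP: mH => /trees_on_arcs.
  rewrite HE in mH *.
  have [A mA AH] := minimal_tree_extends dV vV convex atZ mH.
  have [sZ _] := labeled_atom_stable dV vV convex atZ mA.
  exists ([set: T], A); rewrite induced_stable // out_restriction_stable //.
  by rewrite AH.
split=> //; first by apply: eq_in_imset => F /restr[].
apply/setP => H; apply/imsetP/idP => [[F /restr[_ mF] ->] //|].
by case/extend=> G [mG _ <-]; exists G.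
Qed.
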